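(* Let $k>2$ be odd and let $P(\lambda)=\sum_{i=0}^{k}A_i\lambda^i$, $A_i\in\mathbb{C}^{n\times n}$, be a matrix polynomial of degree $k$ with $A_0\neq0$. Let $(z,\delta)$, with $z\in\mathbb{C}^{nk}$ and $\delta\in\mathbb{C}$, be an approximate right eigenpair of $\mathcal{T}_P(\lambda)$, and let $x=(e_1^T\otimes I_n)z$ if $|\delta|>1$ and $x=(e_k^T\otimes I_n)z$ if $|\delta|\le1$. Assume that $x\neq 0$ and $\eta_{\mathcal{T}_P}(z,\delta)\ne0$, so that the quotients below are defined. Let $$\rho':=\frac{\max_{i=0,\ldots,k}\{1,\|A_i\|_2^2\}}{\min\{\|A_k\|_2,\|A_0\|_2\}}.$$ Then $(x,\delta)$ is an approximate right eigenpair of $P(\lambda)$ and $$\frac{\eta_P(x,\delta)}{\eta_{\mathcal{T}_P}(z,\delta)}\le 4k^{3/2}\,\frac{\|z\|_2}{\|x\|_2}\,\rho'.$$ Moreover, if $|\delta|\ne1$ and $\min\{|\delta|,\frac{1}{|\delta|}\}\le\frac{1}{k-1}$ (with $1/|\delta|=\infty$ if $\delta=0$), then $$\frac{\eta_P(x,\delta)}{\eta_{\mathcal{T}_P}(z,\delta)}\le4\sqrt{k+1}\,\frac{\|z\|_2}{\|x\|_2}\,\rho'.$$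
   Context: $\|\cdot\|_2$ is the Euclidean norm of vectors and the spectral norm of matrices; $e_i$ is the $i$th column of $I_k$. $P$ has degree $k$ if $A_k\ne0$. Backward error. An approximate right eigenpair of a matrix polynomial is a pair consisting of a nonzero vector (of appropriate size) and a complex number, regarded as an approximation to a right eigenvector and its eigenvalue. For a matrix polynomial $Q(\lambda)=\sum_{i=0}^{d}B_i\lambda^i$ of degree $d$ (in particular a pencil $Q(\lambda)=\lambda L_1-L_0$) and such a pair $(v,\delta)$, the normwise backward error is $$\eta_Q(v,\delta)=\min\{\epsilon:(Q(\delta)+\Delta Q(\delta))v=0,\ \|\Delta B_i\|_2\le\epsilon\|B_i\|_2,\ i=0,\ldots,d\},\qquad \Delta Q(\lambda)=\sum_i\lambda^i\Delta B_i,$$ and it is known that $$\eta_Q(v,\delta)=\frac{\|Q(\delta)v\|_2}{\left(\sum_{i=0}^d|\delta|^i\|B_i\|_2\right)\|v\|_2}.$$ The pencil $\mathcal{T}_P(\lambda)$. For $k$ odd, $\mathcal{T}_P(\lambda)$ is the $nk\times nk$ block-tridiagonal pencil, viewed as a $k\times k$ block matrix with $n\times n$ blocks, whose block $(2i+1,2i+1)$ is $\lambda A_{k-2i}+A_{k-2i-1}$ for $i=0,\ldots,\frac{k-1}{2}$; whose blocks $(2i,2i)$ are $0$, whose blocks $(2i-1,2i)$ and $(2i,2i-1)$ are $-I_n$, and whose blocks $(2i,2i+1)$ and $(2i+1,2i)$ are $\lambda I_n$, for $i=1,\ldots,\frac{k-1}{2}$; all other blocks are $0$. *)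

(* Defs.v *)
From mathcomp Require Import all_boot all_order all_algebra.
From mathcomp Require Import classical_sets reals exp.
From mathcomp Require Import complex mxtens.

Set Implicit Arguments.
Unset Strict Implicit.
Unset Printing Implicit Defensive.

Import Order.TTheory GRing.Theory Num.Theory.
Local Open Scope classical_set_scope.
Local Open Scope ring_scope.

(* The field of complex numbers is R[i]. Its own norm `|z| is R[i]-valued; the
   real-valued modulus is Normc.normc. *)
Definition modulus (R : realType) (z : R[i]) : R := Normc.normc z.

Definition norm2 (R : realType) (m : nat) (v : 'cV[R[i]]_m) : R :=
  Num.sqrt (\sum_(i < m) modulus (v i ord0) ^+ 2).

(* The operator norm induced by norm2. *)
Definition spectral_norm (R : realType) (m n : nat) (M : 'M[R[i]]_(m, n)) : R :=
  sup [set norm2 (M *m v) | v in [set v : 'cV[R[i]]_n | norm2 v <= 1]].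

(* A matrix polynomial \sum_(i <= d) B_i X^i is given by its coefficients
   B : 'I_d.+1 -> 'M_n; it has degree d when B ord_max != 0. *)
Definition mxpoly_eval (R : realType) (d n : nat)
    (B : 'I_d.+1 -> 'M[R[i]]_n) (delta : R[i]) : 'M[R[i]]_n :=
  \sum_(i < d.+1) delta ^+ i *: B i.

(* B only fixes the size of v: nothing is required of delta, and the pair need
   not be close to an exact eigenpair. *)
Definition approx_right_eigenpair (R : realType) (d n : nat)
    (B : 'I_d.+1 -> 'M[R[i]]_n) (v : 'cV[R[i]]_n) (delta : R[i]) : Prop :=
  v != 0.

(* If v != 0 and \sum_i modulus delta ^+ i * spectral_norm (B i) != 0, this
   infimum is attained, so that it is a minimum. *)
Definition backward_error (R : realType) (d n : nat)
    (B : 'I_d.+1 -> 'M[R[i]]_n) (v : 'cV[R[i]]_n) (delta : R[i]) : R :=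
  inf [set eps : R | exists DB : 'I_d.+1 -> 'M[R[i]]_n,
    (mxpoly_eval B delta + mxpoly_eval DB delta) *m v = 0 /\
    forall i, spectral_norm (DB i) <= eps * spectral_norm (B i)].

(* Position (i, a) of a k-block vector with blocks of size n is the index
   mxtens_index (i, a) = i * n + a, as for Kronecker products. *)
Definition blockmx (R : realType) (k n : nat)
    (B : 'I_k -> 'I_k -> 'M[R[i]]_n) : 'M[R[i]]_(k * n) :=
  \matrix_(p, q) B (mxtens_unindex p).1 (mxtens_unindex q).1
                   (mxtens_unindex p).2 (mxtens_unindex q).2.

(* Blocks are numbered from 1: r and c are the 1-based block row and column.
   At an odd diagonal position r = c = 2 * i + 1, one has
   k - 2 * i = k.+1 - r and k - 2 * i - 1 = k - r. *)
Definition T_coef1 (R : realType) (k n : nat)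
    (A : 'I_k.+1 -> 'M[R[i]]_n) : 'M[R[i]]_(k * n) :=
  blockmx (fun i j : 'I_k =>
    let r := i.+1 in let c := j.+1 in
    if (r == c) && odd r then A (inord (k.+1 - r))
    else if ~~ odd r && (c == r.+1) || ~~ odd c && (r == c.+1) then 1%:M
    else 0).

Definition T_coef0 (R : realType) (k n : nat)
    (A : 'I_k.+1 -> 'M[R[i]]_n) : 'M[R[i]]_(k * n) :=
  blockmx (fun i j : 'I_k =>
    let r := i.+1 in let c := j.+1 in
    if (r == c) && odd r then A (inord (k - r))
    else if odd r && (c == r.+1) || odd c && (r == c.+1) then - 1%:M
    else 0).

(* The pencil X * T_coef1 A + T_coef0 A, for k odd. *)
Definition T_pencil (R : realType) (k n : nat)
    (A : 'I_k.+1 -> 'M[R[i]]_n) : 'I_2 -> 'M[R[i]]_(k * n) :=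
  fun m => if m == ord0 then T_coef0 A else T_coef1 A.

(* The j-th column of the identity matrix of size k, with 1 <= j <= k. *)
Definition unit_col (R : realType) (k j : nat) : 'cV[R[i]]_k :=
  \col_(i < k) (i.+1 == j)%:R.

(* (e_j^T *t I_n) z; the cast identifies 1 * n with n. *)
Definition block_extract (R : realType) (k n j : nat)
    (z : 'cV[R[i]]_(k * n)) : 'cV[R[i]]_n :=
  castmx (mul1n n, erefl 1%N)
    ((((unit_col R k j)^T *t (1%:M : 'M[R[i]]_n)) : 'M[R[i]]_(1 * n, k * n))
       *m z).

Definition recovered_vec (R : realType) (k n : nat)
    (z : 'cV[R[i]]_(k * n)) (delta : R[i]) : 'cV[R[i]]_n :=
  if 1 < modulus delta then block_extract 1 z else block_extract k z.

Definition rho' (R : realType) (k n : nat) (A : 'I_k.+1 -> 'M[R[i]]_n) : R :=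
  \big[Num.max/1]_(i < k.+1) (spectral_norm (A i) ^+ 2)
    / Num.min (spectral_norm (A ord_max)) (spectral_norm (A ord0)).

(* Main.v *)
Require Import Defs.
From mathcomp Require Import all_boot all_order all_algebra.
From mathcomp Require Import classical_sets reals exp.
From mathcomp Require Import complex mxtens.
From mathcomp Require Import ring lra zify.

(** Write [k = 2 m + 1], [y_r] and [w_r] for the [r]-th blocks of [z] and of
    [w = T(delta) z].  The even block rows read
    [delta y_(r+1) = y_(r-1) + w_r], so all the odd blocks are powers of [delta]
    times [x], up to errors controlled by [w].  Weighting the odd block rows by
    powers of [delta] makes the even blocks of [z] telescope away; substituting
    the odd blocks leaves [P(delta) x] on one side and a combination of the
    [w_r] on the other.  With [K^2 = max (1, |A_i|^2)] and
    [tau = min (|delta|, 1 / |delta|)], this gives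
    [|P(delta) x| <= max (1, 2 m tau) K sqrt k |w|] (times [|delta|^(2 m)] if
    [|delta| > 1]).  Both coefficients of the pencil have spectral norm at most
    [2 K], and the bounds follow from the closed formula for backward errors. *)

Import Order.TTheory GRing.Theory Num.Theory.
Local Open Scope ring_scope.

Set Implicit Arguments.
Unset Strict Implicit.
Unset Printing Implicit Defensive.

(** * Cauchy-Schwarz and Minkowski inequalities for finite real sums *)

(** Lagrange's identity: the double sum of [(a i * b j - a j * b i) ^+ 2] equals
    [2 * (Sa * Sb) - 2 * S ^+ 2], and it is nonnegative. *)
Lemma Cauchy_Schwarz_sum (R : rcfType) (I : finType) (a b : I -> R) :
  \sum_i a i * b i
    <= Num.sqrt (\sum_i a i ^+ 2) * Num.sqrt (\sum_i b i ^+ 2).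
Proof.
set S := \sum_i a i * b i.
set Sa := \sum_i a i ^+ 2; set Sb := \sum_i b i ^+ 2.
have a_ge0 : 0 <= Sa by apply: sumr_ge0 => i _; exact: sqr_ge0.
have b_ge0 : 0 <= Sb by apply: sumr_ge0 => i _; exact: sqr_ge0.
have SabE (u v : I -> R) :
    (\sum_i u i) * (\sum_j v j) = \sum_i \sum_j u i * v j.
  by rewrite mulr_suml; apply: eq_bigr => i _; rewrite mulr_sumr.
have lagrange :
    \sum_i \sum_j (a i * b j - a j * b i) ^+ 2 = 2 * (Sa * Sb) - 2 * S ^+ 2.
  have -> : 2 * (Sa * Sb) - 2 * S ^+ 2 = Sa * Sb + Sb * Sa - 2 * (S * S).
    by ring.
  rewrite !SabE mulr_sumr -big_split -sumrB; apply: eq_bigr => i _ /=.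
  rewrite mulr_sumr -big_split -sumrB; apply: eq_bigr => j _ /=.
  by ring.
have : 0 <= 2 * (Sa * Sb) - 2 * S ^+ 2.
  by rewrite -lagrange; do 2 (apply: sumr_ge0 => ? _); exact: sqr_ge0.
rewrite subr_ge0 ler_pM2l ?ltr0n// => S2_le.
rewrite -sqrtrM// (le_trans (ler_norm S))// -sqrtr_sqr.
by rewrite ler_wsqrtr.
Qed.

Lemma sqrt_sum_sqrD (R : rcfType) (I : finType) (a b : I -> R) :
  Num.sqrt (\sum_i (a i + b i) ^+ 2)
    <= Num.sqrt (\sum_i a i ^+ 2) + Num.sqrt (\sum_i b i ^+ 2).
Proof.
have CS := Cauchy_Schwarz_sum a b.
have a_ge0 : 0 <= \sum_i a i ^+ 2 by apply: sumr_ge0 => i _; exact: sqr_ge0.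
have b_ge0 : 0 <= \sum_i b i ^+ 2 by apply: sumr_ge0 => i _; exact: sqr_ge0.
rewrite -[leRHS]ger0_norm ?addr_ge0 ?sqrtr_ge0// -sqrtr_sqr ler_wsqrtr//.
rewrite sqrrD !sqr_sqrtr//.
under eq_bigr do rewrite sqrrD.
rewrite !big_split /= lerD2r lerD2l.
by rewrite mulr2n lerD.
Qed.

Lemma sum_le_sqrt_sum_sqr (R : rcfType) (k : nat) (f : 'I_k -> R) :
  \sum_i f i <= Num.sqrt k%:R * Num.sqrt (\sum_i f i ^+ 2).
Proof.
have := Cauchy_Schwarz_sum (fun=> 1) f.
under eq_bigr do rewrite mul1r.
by under [\sum_(i : 'I_k) 1 ^+ 2]eq_bigr do rewrite expr1n;
  rewrite sumr_const card_ord.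
Qed.

(** * Euclidean and spectral norms, and the closed formula for backward errors *)

Section Norms.
Variable R : realType.
Implicit Types (m n : nat) (c : R[i]).

Lemma modulus_ge0 c : 0 <= modulus c.
Proof. by case: c => a b; exact: sqrtr_ge0. Qed.

Lemma modulus0 : modulus (0 : R[i]) = 0.
Proof. exact: Normc.normc0. Qed.

Lemma modulus0_eq0 c : modulus c = 0 -> c = 0.
Proof. exact: Normc.eq0_normc. Qed.

Lemma modulus_gt0 c : (0 < modulus c) = (c != 0).
Proof.
rewrite lt_def modulus_ge0 andbT; congr negb; apply/eqP/eqP => [|->].
  exact: modulus0_eq0.
exact: modulus0.
Qed.

Lemma modulusM c c' : modulus (c * c') = modulus c * modulus c'.
Proof. exact: Normc.normcM. Qed.

Lemma modulusX c p : modulus (c ^+ p) = modulus c ^+ p.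
Proof.
elim: p => [|p IHp]; first by rewrite !expr0; exact: Normc.normc1.
by rewrite !exprS modulusM IHp.
Qed.

Lemma modulusV c : modulus c^-1 = (modulus c)^-1.
Proof. exact: Normc.normcV. Qed.

Lemma modulusD c c' : modulus (c + c') <= modulus c + modulus c'.
Proof. exact: le_normcD. Qed.

Lemma modulusN c : modulus (- c) = modulus c.
Proof. exact: normcN. Qed.

Lemma modulus_conj c : modulus (conjc c) = modulus c.
Proof. by case: c => a b; rewrite /modulus /= sqrrN. Qed.

Lemma modulus_real (a : R) : modulus (a%:C)%C = `|a|.
Proof. by rewrite /modulus /= expr0n /= addr0 sqrtr_sqr. Qed.

Lemma mul_conjc c : conjc c * c = ((modulus c ^+ 2)%:C)%C.
Proof.
case: c => a b; rewrite /modulus /= sqr_sqrtr ?addr_ge0 ?sqr_ge0//.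
by apply/eqP; rewrite eq_complex /=; apply/andP; split; apply/eqP; ring.
Qed.

Lemma modulus_sum (I : Type) (r : seq I) (P : pred I) (F : I -> R[i]) :
  modulus (\sum_(i <- r | P i) F i) <= \sum_(i <- r | P i) modulus (F i).
Proof.
elim/big_ind2: _ => [|x x' y y' lx ly|//]; first by rewrite modulus0.
by rewrite (le_trans (modulusD _ _)) ?lerD.
Qed.

Lemma norm2_ge0 m (v : 'cV[R[i]]_m) : 0 <= norm2 v.
Proof. exact: sqrtr_ge0. Qed.

Lemma sqr_norm2 m (v : 'cV[R[i]]_m) :
  norm2 v ^+ 2 = \sum_i modulus (v i ord0) ^+ 2.
Proof. by rewrite sqr_sqrtr// sumr_ge0// => i _; rewrite sqr_ge0. Qed.

Lemma norm2_eq0 m (v : 'cV[R[i]]_m) : (norm2 v == 0) = (v == 0).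
Proof.
apply/eqP/eqP => [v0|->]; last first.
  rewrite /norm2 big1 ?sqrtr0// => i _.
  by rewrite mxE modulus0 expr0n.
apply/colP => i; rewrite mxE; apply: modulus0_eq0; apply/eqP.
rewrite -sqrf_eq0; apply/eqP.
have /psumr_eq0P h : forall i, true -> 0 <= modulus (v i ord0) ^+ 2.
  by move=> ? _; exact: sqr_ge0.
by apply: h; rewrite // -sqr_norm2 v0 expr0n.
Qed.

Lemma norm20 m : norm2 (0 : 'cV[R[i]]_m) = 0.
Proof. by apply/eqP; rewrite norm2_eq0. Qed.

Lemma norm2_gt0 m (v : 'cV[R[i]]_m) : (0 < norm2 v) = (v != 0).
Proof. by rewrite lt_def norm2_ge0 andbT norm2_eq0. Qed.

Lemma norm2D m (u v : 'cV[R[i]]_m) : norm2 (u + v) <= norm2 u + norm2 v.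
Proof.
apply: le_trans (sqrt_sum_sqrD _ _); apply: ler_wsqrtr; apply: ler_sum => i _.
by rewrite lerXn2r ?nnegrE ?addr_ge0 ?modulus_ge0// mxE modulusD.
Qed.

Lemma norm2Z m c (v : 'cV[R[i]]_m) : norm2 (c *: v) = modulus c * norm2 v.
Proof.
rewrite /norm2; under eq_bigr do rewrite mxE modulusM exprMn.
by rewrite -mulr_sumr sqrtrM ?sqr_ge0// sqrtr_sqr ger0_norm ?modulus_ge0.
Qed.

Lemma norm2N m (v : 'cV[R[i]]_m) : norm2 (- v) = norm2 v.
Proof. by rewrite /norm2; under eq_bigr do rewrite mxE modulusN. Qed.

Lemma norm2B m (u v : 'cV[R[i]]_m) : norm2 (u - v) <= norm2 u + norm2 v.
Proof. by rewrite -[norm2 v]norm2N norm2D. Qed.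

Lemma norm2_sum m (I : Type) (r : seq I) (P : pred I) (F : I -> 'cV[R[i]]_m) :
  norm2 (\sum_(i <- r | P i) F i) <= \sum_(i <- r | P i) norm2 (F i).
Proof.
elim/big_ind2: _ => [|x x' y y' lx ly|//]; first by rewrite norm20.
by rewrite (le_trans (norm2D _ _)) ?lerD.
Qed.

Lemma modulus_dot_le m (u : 'rV[R[i]]_m) (v : 'cV[R[i]]_m) :
  modulus ((u *m v) ord0 ord0) <= norm2 u^T * norm2 v.
Proof.
rewrite mxE (le_trans (modulus_sum _ _ _))//.
under eq_bigr do rewrite modulusM.
rewrite /norm2; under [X in Num.sqrt X * _]eq_bigr do rewrite mxE.
exact: Cauchy_Schwarz_sum.
Qed.

(** A crude bound, which serves to show that the supremum defining [spectral_norm] is over a bounded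
    set. *)
Lemma norm2_mulmx_Frobenius m n (M : 'M[R[i]]_(m, n)) (v : 'cV[R[i]]_n) :
  norm2 (M *m v) <= Num.sqrt (\sum_i norm2 (row i M)^T ^+ 2) * norm2 v.
Proof.
rewrite -[leRHS]ger0_norm ?mulr_ge0 ?sqrtr_ge0// -sqrtr_sqr ler_wsqrtr//.
rewrite exprMn sqr_sqrtr ?sumr_ge0// => [|i _]; last exact: sqr_ge0.
rewrite mulr_suml; apply: ler_sum => i _; rewrite -exprMn.
rewrite lerXn2r ?nnegrE ?mulr_ge0 ?modulus_ge0 ?norm2_ge0//.
have -> : (M *m v) i ord0 = (row i M *m v) ord0 ord0.
  by rewrite -row_mul [RHS]mxE.
exact: modulus_dot_le.
Qed.

Lemma norm2_mulmx m n (M : 'M[R[i]]_(m, n)) (v : 'cV[R[i]]_n) :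
  norm2 (M *m v) <= spectral_norm M * norm2 v.
Proof.
have [->|v_neq0] := eqVneq v 0; first by rewrite mulmx0 !norm20 mulr0.
have v_gt0 : 0 < norm2 v by rewrite norm2_gt0.
rewrite -ler_pdivrMr//; apply: ub_le_sup.
  exists (Num.sqrt (\sum_i norm2 (row i M)^T ^+ 2)) => _ [w /= w_le1 <-].
  apply: (le_trans (norm2_mulmx_Frobenius _ _)).
  by rewrite -[leRHS]mulr1 ler_wpM2l ?sqrtr_ge0.
have normV : modulus ((norm2 v)^-1%:C)%C = (norm2 v)^-1.
  by rewrite modulus_real ger0_norm// invr_ge0 norm2_ge0.
exists (((norm2 v)^-1%:C)%C *: v) => /=.
  by rewrite norm2Z normV mulVf ?gt_eqF.
by rewrite -scalemxAr norm2Z normV mulrC.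
Qed.

Lemma spectral_norm_le m n (M : 'M[R[i]]_(m, n)) (c : R) :
  0 <= c -> (forall v, norm2 (M *m v) <= c * norm2 v) -> spectral_norm M <= c.
Proof.
move=> c_ge0 Mle; apply: ge_sup.
  by exists (norm2 (M *m 0)), 0 => //=; rewrite norm20 ler01.
move=> _ [w /= w_le1 <-]; apply: (le_trans (Mle w)).
by rewrite -[leRHS]mulr1 ler_wpM2l.
Qed.

(** If the supremum were negative, [norm2_mulmx] would make every [M *m v] vanish, and it would be
    the supremum of {0}, which is 0. *)
Lemma spectral_norm_ge0 m n (M : 'M[R[i]]_(m, n)) : 0 <= spectral_norm M.
Proof.
rewrite leNgt; apply/negP => M_lt0.
have M_le v : norm2 (M *m v) <= 0.
  by apply: (le_trans (norm2_mulmx _ _)); rewrite nmulr_rle0 ?norm2_ge0.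
move: M_lt0; rewrite /spectral_norm.
rewrite (_ : [set _ | _ in _]%classic = [set 0]%classic) ?sup1 ?ltxx//.
apply/seteqP; split => [_ [v _ <-] /=|_ ->].
  by apply/eqP; rewrite eq_le M_le norm2_ge0.
by exists 0; rewrite /= ?mulmx0 norm20 ?ler01.
Qed.

Lemma spectral_norm_gt0 m n (M : 'M[R[i]]_(m, n)) :
  M != 0 -> 0 < spectral_norm M.
Proof.
move=> M_neq0; rewrite lt_def spectral_norm_ge0 andbT.
apply: contra M_neq0 => /eqP M0; apply/eqP/matrixP => i j.
have /eqP/colP/(_ i) : col j M == 0.
  rewrite colE -norm2_eq0 eq_le norm2_ge0 andbT.
  by rewrite (le_trans (norm2_mulmx _ _))// M0 mul0r.
by rewrite !mxE.
Qed.

Lemma norm2_mxpoly_eval d n (B : 'I_d.+1 -> 'M[R[i]]_n) (v : 'cV[R[i]]_n)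
    (delta : R[i]) :
  norm2 (mxpoly_eval B delta *m v)
    <= (\sum_(i < d.+1) modulus delta ^+ i * spectral_norm (B i)) * norm2 v.
Proof.
rewrite /mxpoly_eval !mulmx_suml; apply: (le_trans (norm2_sum _ _ _)).
rewrite mulr_suml; apply: ler_sum => i _.
by rewrite -scalemxAl norm2Z modulusX -mulrA ler_wpM2l ?exprn_ge0 ?modulus_ge0
  ?norm2_mulmx.
Qed.

(* The minimum is attained by the rank-one perturbations
   [- c_i r v^* / |v|^2], r the residual, where
   [delta^i c_i = |delta|^i |B_i| / S]. *)
Lemma backward_errorE d n (B : 'I_d.+1 -> 'M[R[i]]_n) (v : 'cV[R[i]]_n)
    (delta : R[i])
    (S := \sum_(i < d.+1) modulus delta ^+ i * spectral_norm (B i)) :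
  v != 0 -> 0 < S ->
  backward_error B v delta
    = norm2 (mxpoly_eval B delta *m v) / (S * norm2 v).
Proof.
move=> v_neq0 S_gt0; set r := mxpoly_eval B delta *m v.
have v_gt0 : 0 < norm2 v by rewrite norm2_gt0.
have Sv_gt0 : 0 < S * norm2 v by rewrite mulr_gt0.
have lb eps : (exists DB : 'I_d.+1 -> 'M[R[i]]_n,
    (mxpoly_eval B delta + mxpoly_eval DB delta) *m v = 0 /\
    forall i, spectral_norm (DB i) <= eps * spectral_norm (B i)) ->
    norm2 r / (S * norm2 v) <= eps.
  move=> [DB [DBv DBle]]; rewrite ler_pdivrMr// mulrA.
  have -> : r = - (mxpoly_eval DB delta *m v).
    by apply/eqP; rewrite -addr_eq0 -mulmxDl DBv.
  rewrite norm2N (le_trans (norm2_mxpoly_eval _ _ _))// ler_wpM2r ?norm2_ge0//.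
  rewrite mulr_sumr; apply: ler_sum => i _.
  by rewrite mulrCA ler_wpM2l ?exprn_ge0 ?modulus_ge0.
(* [t] is the phase that turns [delta] into its modulus. At [delta = 0] division gives [t = 0], so
   that only the perturbation of [B ord0] survives; hence [t_le1] is an inequality. *)
pose t := conjc delta / ((modulus delta)%:C)%C.
have t_delta : t * delta = ((modulus delta)%:C)%C.
  rewrite /t mulrAC mul_conjc rmorphXn /= expr2.
  have [->|d_neq0] := eqVneq delta 0; first by rewrite modulus0 !mul0r.
  by rewrite mulfK// (inj_eq (@complexI R)) gt_eqF// modulus_gt0.
have t_le1 : modulus t <= 1.
  rewrite /t modulusM modulusV modulus_conj modulus_real.
  rewrite ger0_norm ?modulus_ge0//.
  have [->|d_neq0] := eqVneq delta 0; first by rewrite modulus0 mul0r ler01.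
  by rewrite divff// gt_eqF// modulus_gt0.
(* Normalized so that the sum of |delta|^i g_i |v|^2 is 1, which makes the perturbation cancel the
   residual exactly. *)
pose g (i : 'I_d.+1) := spectral_norm (B i) / (S * norm2 v ^+ 2).
have g_ge0 i : 0 <= g i.
  by rewrite divr_ge0 ?spectral_norm_ge0// mulr_ge0 ?sqr_ge0// ltW.
pose vs : 'rV[R[i]]_n := \row_j conjc (v j ord0).
have vsTE : norm2 vs^T = norm2 v.
  by rewrite /norm2; under eq_bigr do rewrite !mxE modulus_conj.
have vsv : vs *m v = ((norm2 v ^+ 2)%:C)%C%:M.
  apply/matrixP => i j; rewrite !ord1 !mxE eqxx mulr1n sqr_norm2 rmorph_sum.
 by apply: eq_bigr => l _; rewrite mxE mul_conjc.
pose DB (i : 'I_d.+1) := - (t ^+ i * ((g i)%:C)%C) *: (r *m vs).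
suff mem : exists DB : 'I_d.+1 -> 'M[R[i]]_n,
    (mxpoly_eval B delta + mxpoly_eval DB delta) *m v = 0 /\
    forall i, spectral_norm (DB i)
      <= norm2 r / (S * norm2 v) * spectral_norm (B i).
  apply/eqP; rewrite eq_le; apply/andP; split.
    by apply: ge_inf mem; exists (norm2 r / (S * norm2 v)) => eps; exact: lb.
  by apply: lb_le_inf => [|eps]; [exists (norm2 r / (S * norm2 v))|exact: lb].
exists DB; split.
  rewrite mulmxDl -/r {1}/mxpoly_eval mulmx_suml.
  under eq_bigr => i _.
    rewrite scalerA -scalemxAl -mulmxA vsv mul_mx_scalar scalerA.
    over.
  rewrite -scaler_suml -{1}[r]scale1r -scalerDl.
  rewrite (_ : 1 + _ = 0) ?scale0r//.
  under eq_bigr => i _.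
    rewrite mulrN mulNr mulrA -exprMn [delta * t]mulrC t_delta.
    rewrite -!rmorphXn -!rmorphM /=.
    over.
  rewrite sumrN -rmorph_sum /=; apply/eqP; rewrite subr_eq0; apply/eqP.
  rewrite -[LHS](rmorph1 (real_complex R)); congr (_ %:C)%C.
  rewrite -mulr_suml /g.
  under eq_bigr do rewrite mulrA.
  by rewrite -mulr_suml -/S; field; rewrite !gt_eqF.
move=> i; apply: spectral_norm_le.
  by rewrite mulr_ge0 ?spectral_norm_ge0// divr_ge0 ?norm2_ge0 ?(ltW Sv_gt0).
move=> w; rewrite -scalemxAl norm2Z -mulmxA.
rewrite [vs *m w]mx11_scalar mul_mx_scalar norm2Z modulusN modulusM.
rewrite modulus_real ger0_norm// modulusX.
(* Cauchy-Schwarz for v^* w bounds the norm of the rank-one matrix [DB i] by g_i |r| |v|. *)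
have vsw := modulus_dot_le vs w; rewrite vsTE in vsw.
apply: (@le_trans _ _ (g i * (norm2 v * norm2 w * norm2 r))).
  apply: ler_pM.
  - by rewrite mulr_ge0// exprn_ge0// modulus_ge0.
  - by rewrite mulr_ge0 ?modulus_ge0 ?norm2_ge0.
  - by rewrite ler_piMl// exprn_ile1// modulus_ge0.
  - by rewrite ler_wpM2r ?norm2_ge0.
rewrite le_eqVlt; apply/orP; left; apply/eqP.
by rewrite /g; field; rewrite !gt_eqF.
Qed.

End Norms.

(** * Propagation of errors along the recurrence between odd blocks, in abstract form *)

Lemma big_ord_double (V : nmodType) (p : nat) (F : nat -> V) :
  \sum_(i < p.*2) F i = \sum_(i < p) (F i.*2 + F i.*2.+1).
Proof.
elim: p => [|p IHp]; first by rewrite !big_ord0.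
by rewrite doubleS !big_ord_recr /= IHp addrA.
Qed.

Lemma double_addnB (i m : nat) : (i <= m)%N -> (i.*2 + (m - i) = m + i)%N.
Proof. by move=> im; rewrite -addnn -addnA subnKC// addnC. Qed.

Section Recovery.
(** In the application [a] and [u] list the odd blocks of z and w from the last to the first, [e]
    lists the even blocks of w, and [c i] is delta A_(2i+1) + A_(2i). [C] is any bound on max (1, 2
    m tau). *)
Variables (R : realType) (n m : nat) (delta : R[i]).
Variables (a u e : nat -> 'cV[R[i]]_n) (c : nat -> 'M[R[i]]_n) (K C : R).
Hypothesis recE : forall i, (i < m)%N -> delta *: a i = a i.+1 + e i.
Hypothesis sumE : \sum_(i < m.+1) delta ^+ i *: u i
  = \sum_(i < m.+1) delta ^+ i *: (c i *m a i).
Hypotheses (K_ge1 : 1 <= K) (C_ge1 : 1 <= C).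

Let W := \sum_(i < m.+1) (norm2 (u i) + norm2 (e i)).

Let KC_ge1 : 1 <= C * K.
Proof. by rewrite (le_trans K_ge1)// ler_peMl// (le_trans ler01). Qed.

Let sum_e_le p : (p <= m)%N ->
  \sum_(i < p) norm2 (e i) <= \sum_(i < m) norm2 (e i).
Proof.
move=> pm; rewrite (big_ord_widen m (fun i => norm2 (e i)))//.
rewrite [leRHS](bigID (fun i : 'I_m => (i < p)%N)) /= lerDl sumr_ge0// => i _.
exact: norm2_ge0.
Qed.

Let W_ge :
  \sum_(i < m.+1) norm2 (u i) + \sum_(i < m) norm2 (e i) <= W.
Proof.
by rewrite /W big_split lerD2l [leRHS]big_ord_recr lerDl norm2_ge0.
Qed.

(** For |delta| <= 1 the recurrence is run forward from [a 0]: multiplication by [delta] does not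
    amplify the errors, so [a i] differs from delta^i [a 0] by at most the sum of the |e_j|. *)
Lemma recovery_small :
  modulus delta <= 1 -> 2 * m%:R * modulus delta <= C ->
  (forall i v, (i <= m)%N -> norm2 (c i *m v) <= 2 * K * norm2 v) ->
  norm2 ((\sum_(i < m.+1) delta ^+ i.*2 *: c i) *m a 0%N) <= C * K * W.
Proof.
move=> d_le1 md_le c_le; set d := modulus delta in d_le1 md_le *.
have d_ge0 : 0 <= d := modulus_ge0 _.
have K_ge0 : 0 <= K := le_trans ler01 K_ge1.
set E := \sum_(i < m) norm2 (e i).
have E_ge0 : 0 <= E by apply: sumr_ge0 => i _; exact: norm2_ge0.
have drift p : (p <= m)%N ->
    norm2 (delta ^+ p *: a 0%N - a p) <= \sum_(i < p) norm2 (e i).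
  elim: p => [|p IHp] pm; first by rewrite expr0 scale1r subrr norm20 big_ord0.
  rewrite big_ord_recr /=.
  have -> : delta ^+ p.+1 *: a 0%N - a p.+1
      = delta *: (delta ^+ p *: a 0%N - a p) + e p.
    by rewrite scalerBr recE// scalerA exprS opprD addrA subrK.
  rewrite (le_trans (norm2D _ _))// lerD2r norm2Z.
  by rewrite (le_trans _ (IHp (ltnW pm)))// ler_piMl ?norm2_ge0.
(* Replacing [a i] by delta^i [a 0] in [sumE] produces P(delta) [a 0]; the second sum is the cost of
   the replacement. *)
have -> : (\sum_(i < m.+1) delta ^+ i.*2 *: c i) *m a 0%N
    = \sum_(i < m.+1) delta ^+ i *: u i
      + \sum_(i < m.+1) delta ^+ i *: (c i *m (delta ^+ i *: a 0%N - a i)).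
  rewrite sumE mulmx_suml -big_split; apply: eq_bigr => i _ /=.
  rewrite -scalerDr -mulmxDr addrC subrK -scalemxAl -scalemxAr scalerA.
  by rewrite -exprD addnn.
apply: (le_trans (norm2D _ _)); apply: le_trans (ler_wpM2l _ W_ge); last first.
  exact: le_trans KC_ge1.
rewrite mulrDr; apply: lerD.
  apply: (le_trans (norm2_sum _ _ _)).
  apply: (@le_trans _ _ (\sum_(i < m.+1) norm2 (u i))).
    apply: ler_sum => i _.
    by rewrite norm2Z modulusX ler_piMl ?norm2_ge0// exprn_ile1.
  by rewrite ler_peMl// sumr_ge0// => i _; exact: norm2_ge0.
apply: (le_trans (norm2_sum _ _ _)).
(* The term i = 0 has no drift, and each of the m others carries a factor |delta|: this is the
   origin of 2 m |delta|. *)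
rewrite big_ord_recl expr0 !scale1r subrr mulmx0 norm20 add0r.
apply: (@le_trans _ _ (\sum_(i < m) d * (2 * K * E))).
  apply: ler_sum => i _; rewrite norm2Z modulusX /=.
  apply: ler_pM; rewrite ?exprn_ge0 ?norm2_ge0//.
    by rewrite exprS ler_piMr// exprn_ile1.
  rewrite (le_trans (c_le _ _ _))// ler_wpM2l ?mulr_ge0//.
  by rewrite (le_trans (drift _ _))// sum_e_le.
rewrite sumr_const card_ord -[_ *+ m]mulr_natl.
have -> : m%:R * (d * (2 * K * E)) = (2 * m%:R * d) * (K * E) by ring.
by rewrite -[leRHS]mulrA ler_wpM2r ?mulr_ge0.
Qed.

(** For |delta| >= 1 the reference block is the other end, [a m], compared with delta^(m-i) [a i].
    Errors now grow with powers of [delta], which the factor |delta|^(2m) absorbs. *)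
Lemma recovery_large :
  1 <= modulus delta -> 2 * m%:R <= C * modulus delta ->
  (forall i v, (i <= m)%N ->
    norm2 (c i *m v) <= 2 * K * modulus delta * norm2 v) ->
  norm2 ((\sum_(i < m.+1) delta ^+ i.*2 *: c i) *m a m)
    <= modulus delta ^+ m.*2 * (C * K * W).
Proof.
move=> d_ge1 md_le c_le; set d := modulus delta in d_ge1 md_le c_le *.
have d_gt0 : 0 < d := lt_le_trans ltr01 d_ge1.
have d_ge0 := ltW d_gt0.
have K_ge0 : 0 <= K := le_trans ler01 K_ge1.
set E := \sum_(i < m) norm2 (e i).
have E_ge0 : 0 <= E by apply: sumr_ge0 => i _; exact: norm2_ge0.
(* The errors are multiplied by powers of [delta] up to p - 1; the extra factor [d] on the left
   avoids that subtraction at p = 0. *)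
have drift p : (p <= m)%N ->
    d * norm2 (a m - delta ^+ p *: a (m - p)%N)
      <= d ^+ p * \sum_(i < p) norm2 (e (m - i.+1)%N).
  elim: p => [|p IHp] pm.
    by rewrite expr0 scale1r subn0 subrr norm20 big_ord0 !mulr0.
  rewrite big_ord_recr /= mulrDr.
  have -> : a m - delta ^+ p.+1 *: a (m - p.+1)%N
      = (a m - delta ^+ p *: a (m - p)%N) - delta ^+ p *: e (m - p.+1)%N.
    rewrite exprSr -scalerA recE ?ltn_subrL ?(leq_ltn_trans _ pm)//.
    by rewrite -subSn// subSS scalerDr opprD addrA.
  apply: (le_trans (ler_wpM2l d_ge0 (norm2B _ _))).
  rewrite mulrDr norm2Z modulusX mulrA -exprS lerD2r.
  rewrite (le_trans (IHp (ltnW pm)))// ler_wpM2r ?ler_weXn2l//.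
  by rewrite sumr_ge0// => i _; exact: norm2_ge0.
have sum_rev_le p : (p <= m)%N -> \sum_(i < p) norm2 (e (m - i.+1)%N) <= E.
  move=> pm; rewrite (big_ord_widen m (fun i => norm2 (e (m - i.+1)%N)))//.
  rewrite /E [leRHS](reindex_inj rev_ord_inj).
  rewrite [leRHS](bigID (fun i : 'I_m => (i < p)%N)).
  by rewrite /= lerDl sumr_ge0// => i _; exact: norm2_ge0.
have -> : (\sum_(i < m.+1) delta ^+ i.*2 *: c i) *m a m
    = delta ^+ m *: \sum_(i < m.+1) delta ^+ i *: u i
      + \sum_(i < m.+1) delta ^+ i.*2 *:
          (c i *m (a m - delta ^+ (m - i) *: a i)).
  rewrite sumE mulmx_suml scaler_sumr -big_split; apply: eq_bigr => i _ /=.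
  rewrite mulmxBr scalerBr -scalemxAr !scalerA -!exprD.
  rewrite double_addnB ?leq_ord//.
  by rewrite addrC subrK -scalemxAl.
apply: (le_trans (norm2D _ _)); rewrite mulrA.
apply: le_trans (ler_wpM2l _ W_ge); last first.
  by rewrite mulr_ge0 ?exprn_ge0// (le_trans _ KC_ge1).
rewrite mulrDr; apply: lerD.
  rewrite norm2Z modulusX.
  apply: (@le_trans _ _ (d ^+ m.*2 * \sum_(i < m.+1) norm2 (u i))).
    rewrite -addnn exprD -mulrA ler_wpM2l ?exprn_ge0//.
    apply: (le_trans (norm2_sum _ _ _)); rewrite mulr_sumr ler_sum// => i _.
    by rewrite norm2Z modulusX ler_wpM2r ?norm2_ge0// ler_weXn2l// -ltnS.
  rewrite -[leRHS]mulrA ler_wpM2l ?exprn_ge0// ler_peMl// sumr_ge0// => i _.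
  exact: norm2_ge0.
apply: (le_trans (norm2_sum _ _ _)).
rewrite big_ord_recr /= subnn expr0 scale1r subrr mulmx0 scaler0 norm20 addr0.
(* After multiplication by [d], the i-th term is at most d^(m+i+1) 2 K E, hence at most d^(2m) 2 K E
   as i < m. Summing m terms gives the factor 2 m, bounded by C d. *)
rewrite -(ler_pM2l d_gt0) mulr_sumr.
apply: (@le_trans _ _ (\sum_(i < m) (d ^+ m.*2 * (2 * K * E)))).
  apply: ler_sum => i _; rewrite norm2Z modulusX.
  set y := a m - _.
  have y_le : d * norm2 y <= d ^+ (m - i) * E.
    have := drift (m - i)%N (leq_subr _ _); rewrite subKn ?(ltnW (ltn_ord i))//.
    by move/le_trans; apply; rewrite ler_wpM2l ?exprn_ge0 ?sum_rev_le ?leq_subr.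
  apply: (@le_trans _ _ (d ^+ i.*2 * (2 * K * (d * (d * norm2 y))))).
    rewrite mulrCA ler_wpM2l ?exprn_ge0//.
    have := ler_wpM2l d_ge0 (c_le i y (ltnW (ltn_ord i))).
    by move/le_trans; apply; rewrite le_eqVlt; apply/orP; left; apply/eqP; ring.
  apply: (@le_trans _ _ (d ^+ i.*2 * (2 * K * (d * (d ^+ (m - i) * E))))).
    by rewrite !ler_wpM2l ?exprn_ge0 ?mulr_ge0.
  have -> : d ^+ i.*2 * (2 * K * (d * (d ^+ (m - i) * E)))
      = (d ^+ i.*2 * d * d ^+ (m - i)) * (2 * K * E) by ring.
  rewrite -exprSr -exprD ler_wpM2r ?mulr_ge0// ler_weXn2l//.
  by rewrite addSn double_addnB ?(ltnW (ltn_ord i))// -addnn ltn_add2l.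
rewrite sumr_const card_ord -[_ *+ m]mulr_natl.
have -> : m%:R * (d ^+ m.*2 * (2 * K * E)) = (2 * m%:R) * (d ^+ m.*2 * K * E).
  by ring.
have -> : d * (d ^+ m.*2 * (C * K) * E) = (C * d) * (d ^+ m.*2 * K * E).
  by ring.
by rewrite ler_wpM2r ?mulr_ge0 ?exprn_ge0.
Qed.

End Recovery.

(** * Blocks of vectors and block rows of the pencil *)

Section Blocks.
Variables (R : realType) (k n : nat).
Implicit Types (v w : 'cV[R[i]]_(k * n)) (r : nat).

Lemma sum_mxtens_index (V : nmodType) (F : 'I_(k * n) -> V) :
  \sum_p F p = \sum_(i < k) \sum_(a < n) F (mxtens_index (i, a)).
Proof.
rewrite pair_big (reindex (@mxtens_index k n))/=; last first.
  exists (@mxtens_unindex k n) => p _.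
    by rewrite mxtens_indexK.
  by rewrite mxtens_unindexK.
by apply: eq_bigr => -[].
Qed.

Lemma block_extractE r v a :
  block_extract r v a ord0
    = \sum_(i < k) (i.+1 == r)%:R * v (mxtens_index (i, a)) ord0.
Proof.
rewrite /block_extract castmxE /= cast_ord_id mxE sum_mxtens_index.
rewrite (_ : cast_ord _ a = mxtens_index (ord0, a)); last first.
  by apply: val_inj; rewrite /= mul0n.
apply: eq_bigr => i _; rewrite (bigD1 a)//= big1 ?addr0 => [|b b_neq_a].
  by rewrite tensmxE !mxE eqxx mulr1.
by rewrite tensmxE !mxE [a == b]eq_sym (negPf b_neq_a) mulr0 mul0r.
Qed.

Lemma block_extractS (j : 'I_k) v a :
  block_extract j.+1 v a ord0 = v (mxtens_index (j, a)) ord0.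
Proof.
rewrite block_extractE (bigD1 j)//= eqxx mul1r big1 ?addr0// => i ij.
by rewrite eqSS (_ : (i == j :> nat) = (i == j))// (negPf ij) mul0r.
Qed.

(** Boundary convention: blocks 0 and k + 1 read as zero, so that the first and last block rows
    follow the general formulas. *)
Lemma block_extract_out r v :
  ~~ (0 < r <= k)%N -> block_extract r v = 0.
Proof.
move=> r_out; apply/colP => a; rewrite block_extractE mxE big1// => i _.
rewrite (_ : (_ == _) = false) ?mul0r//; apply: contraNF r_out => /eqP <-.
exact: ltn_ord.
Qed.

Lemma block_extractD r v w :
  block_extract r (v + w) = block_extract r v + block_extract r w.
Proof.
apply/colP => a; rewrite mxE !block_extractE -big_split; apply: eq_bigr => i _.
by rewrite mxE mulrDr.
Qed.

Lemma block_extractZ r c v : block_extract r (c *: v) = c *: block_extract r v.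
Proof.
apply/colP => a; rewrite mxE !block_extractE mulr_sumr; apply: eq_bigr => i _.
by rewrite mxE mulrCA.
Qed.

Lemma sqr_norm2_blocks v :
  norm2 v ^+ 2 = \sum_(j < k) norm2 (block_extract j.+1 v) ^+ 2.
Proof.
rewrite sqr_norm2 sum_mxtens_index; apply: eq_bigr => j _.
by rewrite sqr_norm2; apply: eq_bigr => a _; rewrite block_extractS.
Qed.

Lemma block_extract_blockmx (B : 'I_k -> 'I_k -> 'M[R[i]]_n) (j : 'I_k) v :
  block_extract j.+1 (blockmx B *m v)
    = \sum_(i < k) B j i *m block_extract i.+1 v.
Proof.
apply/colP => a; rewrite block_extractS mxE sum_mxtens_index summxE.
apply: eq_bigr => i _; rewrite mxE; apply: eq_bigr => b _.
by rewrite block_extractS mxE !mxtens_indexK.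
Qed.

(** [r] may be out of range, both sides then being zero; this lets rows at the border refer to a
    missing neighbour. *)
Lemma sum_block_extract1 (X : 'M[R[i]]_n) r v :
  \sum_(i < k) (if i.+1 == r then X else 0) *m block_extract i.+1 v
    = X *m block_extract r v.
Proof.
have [/andP[r_gt0 r_le]|r_out] := boolP (0 < r <= k)%N; last first.
  rewrite block_extract_out// mulmx0 big1// => i _.
  rewrite ifN ?mul0mx//; apply: contraNneq r_out => <-; exact: ltn_ord.
case: r r_gt0 r_le => // r _ r_lt; rewrite (bigD1 (Ordinal r_lt))//= eqxx.
by rewrite big1 ?addr0// => i ir; rewrite ifN ?mul0mx//.
Qed.

Lemma sum_block_extract2 (X Y : 'M[R[i]]_n) r s v : r != s ->
  \sum_(i < k)
      (if i.+1 == r then X else if i.+1 == s then Y else 0)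
        *m block_extract i.+1 v
    = X *m block_extract r v + Y *m block_extract s v.
Proof.
move=> rs; rewrite -!sum_block_extract1 -big_split; apply: eq_bigr => i _ /=.
rewrite -mulmxDl; congr (_ *m _).
have [ir|_] := eqVneq i.+1 r; last by rewrite add0r.
by rewrite ir (negPf rs) addr0.
Qed.

Variable A : 'I_k.+1 -> 'M[R[i]]_n.

Lemma T_coef1_block r v : (0 < r <= k)%N ->
  block_extract r (T_coef1 A *m v)
    = if odd r then A (inord (k.+1 - r)) *m block_extract r v
                    + block_extract r.-1 v
      else block_extract r.+1 v.
Proof.
case: r => // r r_lt; rewrite (block_extract_blockmx _ (Ordinal r_lt)) /=.
have [r_odd|r_even] := ifPn.
  rewrite -[block_extract r v]mul1mx -sum_block_extract2; last by lia.
  apply: eq_bigr => i _; congr (_ *m _).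
  rewrite andbT eq_sym; case: ifP => // _.
  by rewrite (_ : ~~ true && _ || _ = (i.+1 == r))//; lia.
rewrite -[RHS]mul1mx -sum_block_extract1; apply: eq_bigr => i _.
congr (_ *m _); rewrite andbF.
by rewrite (_ : ~~ false && _ || _ = (i.+1 == r.+2))//; lia.
Qed.

Lemma T_coef0_block r v : (0 < r <= k)%N ->
  block_extract r (T_coef0 A *m v)
    = if odd r then A (inord (k - r)) *m block_extract r v
                    - block_extract r.+1 v
      else - block_extract r.-1 v.
Proof.
case: r => // r r_lt; rewrite (block_extract_blockmx _ (Ordinal r_lt)) /=.
have [r_odd|r_even] := ifPn.
  rewrite -[block_extract r.+2 v]mul1mx -mulNmx.
  rewrite -sum_block_extract2; last by lia.
  apply: eq_bigr => i _; congr (_ *m _).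
  rewrite andbT eq_sym; case: ifP => // _.
  by rewrite (_ : true && _ || _ = (i.+1 == r.+2))//; lia.
rewrite -[block_extract r v]mul1mx -mulNmx -sum_block_extract1.
apply: eq_bigr => i _; congr (_ *m _); rewrite andbF.
by rewrite (_ : false && _ || _ = (i.+1 == r))//; lia.
Qed.

End Blocks.

(** * The case k = 2 m + 1: norms of the pencil's coefficients and residual of the recovered
    vector *)

Section OddDegree.
Variables (R : realType) (m n : nat).
Let k := m.*2.+1.
Implicit Types v z : 'cV[R[i]]_(k * n).

(** The zero block 0 completes the k blocks to m + 1 pairs (2i, 2i+1), each of which [T_coef1] maps
    to itself. *)
Lemma sum_blocks_even_odd (V : nmodType) (G : 'cV[R[i]]_n -> V) v : G 0 = 0 ->
  \sum_(j < k) G (block_extract j.+1 v)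
    = \sum_(i < m.+1)
        (G (block_extract i.*2 v) + G (block_extract i.*2.+1 v)).
Proof.
move=> G0; rewrite -(big_ord_double _ (fun r => G (block_extract r v))) doubleS.
by rewrite [RHS]big_ord_recl [block_extract _ v]block_extract_out// G0 add0r.
Qed.

(** Here block k + 1 is the padding, and the pairs (2i+1, 2i+2) are those preserved by [T_coef0]. *)
Lemma sum_blocks_odd_even (V : nmodType) (G : 'cV[R[i]]_n -> V) v : G 0 = 0 ->
  \sum_(j < k) G (block_extract j.+1 v)
    = \sum_(i < m.+1)
        (G (block_extract i.*2.+1 v) + G (block_extract i.*2.+2 v)).
Proof.
move=> G0; rewrite -(big_ord_double _ (fun r => G (block_extract r.+1 v))).
rewrite doubleS [RHS]big_ord_recr /=.
rewrite [block_extract _.+2 v]block_extract_out ?G0 ?addr0//.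
by rewrite ltnn andbF.
Qed.

(** Of the 2 m + 2 norms on the left, that of block 0 is zero, so Cauchy-Schwarz over k terms
    suffices. *)
Lemma sum_norm_blocks_le v :
  \sum_(i < m.+1) (norm2 (block_extract (m - i).*2.+1 v)
                   + norm2 (block_extract (m - i).*2 v))
    <= Num.sqrt k%:R * norm2 v.
Proof.
rewrite -[norm2 v]ger0_norm ?norm2_ge0// -sqrtr_sqr sqr_norm2_blocks.
apply: le_trans (sum_le_sqrt_sum_sqr _).
have -> := sum_blocks_even_odd (G := @norm2 R n) v (norm20 R n).
rewrite [leRHS](reindex_inj rev_ord_inj).
by apply: ler_sum => i _; rewrite /= subSS [leLHS]addrC.
Qed.

(** Estimate for one pair of blocks: (K b + a)^2 <= 2 K^2 b^2 + 2 a^2, and the remaining b^2 is at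
    most K^2 b^2. *)
Lemma sqr_add_le_pair (K a b p q : R) : 1 <= K -> 0 <= p -> 0 <= q ->
  p <= b -> q <= K * b + a ->
  p ^+ 2 + q ^+ 2 <= (2 * K) ^+ 2 * (a ^+ 2 + b ^+ 2).
Proof.
move=> K1 p0 q0 pb qb.
have K2 : 1 <= K ^+ 2 by rewrite expr_ge1// (le_trans ler01).
have p2 : p ^+ 2 <= b ^+ 2 by rewrite lerXn2r ?nnegrE// (le_trans p0).
have q2 : q ^+ 2 <= (K * b + a) ^+ 2.
  by rewrite lerXn2r ?nnegrE// (le_trans q0).
have b2 : b ^+ 2 <= K ^+ 2 * b ^+ 2 by rewrite ler_peMl ?sqr_ge0.
have a2 : a ^+ 2 <= K ^+ 2 * a ^+ 2 by rewrite ler_peMl ?sqr_ge0.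
have ab := sqr_ge0 (K * b - a).
have Kb := sqr_ge0 b.
have Ka := sqr_ge0 a.
rewrite sqrrD exprMn in q2; rewrite sqrrB exprMn in ab; rewrite exprMn mulrDr.
by lra.
Qed.

Variables (A : 'I_k.+1 -> 'M[R[i]]_n) (K : R).
Hypotheses (K_ge1 : 1 <= K) (A_le : forall i, spectral_norm (A i) <= K).

Let K_ge0 : 0 <= K := le_trans ler01 K_ge1.

Let norm2_A_le i (v : 'cV[R[i]]_n) : norm2 (A i *m v) <= K * norm2 v.
Proof.
by rewrite (le_trans (norm2_mulmx _ _))// ler_wpM2r ?norm2_ge0.
Qed.

Let sqr_norm20 : norm2 (0 : 'cV[R[i]]_n) ^+ 2 = 0.
Proof. by rewrite norm20 expr0n. Qed.

(** On the pairs (2i, 2i+1) the matrix is block diagonal with blocks [0, I; I, A_j], so one pair can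
    be bounded at a time. *)
Lemma spectral_norm_T_coef1 : spectral_norm (T_coef1 A) <= 2 * K.
Proof.
apply: spectral_norm_le => [|v]; first by rewrite mulr_ge0.
rewrite -(@ler_pXn2r _ 2)// ?nnegrE ?mulr_ge0 ?norm2_ge0// exprMn.
rewrite !sqr_norm2_blocks !(sum_blocks_even_odd (G := fun u => norm2 u ^+ 2))//.
rewrite mulr_sumr; apply: ler_sum => i _; have im := ltn_ord i.
apply: sqr_add_le_pair; rewrite ?norm2_ge0//.
  have [->|i_gt0] := eqVneq (i : nat) 0%N.
    by rewrite block_extract_out// norm20 norm2_ge0.
  by rewrite T_coef1_block ?odd_double//; lia.
rewrite T_coef1_block /= ?odd_double/=; last by lia.
by rewrite (le_trans (norm2D _ _))// lerD2r.
Qed.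

Lemma spectral_norm_T_coef0 : spectral_norm (T_coef0 A) <= 2 * K.
Proof.
apply: spectral_norm_le => [|v]; first by rewrite mulr_ge0.
rewrite -(@ler_pXn2r _ 2)// ?nnegrE ?mulr_ge0 ?norm2_ge0// exprMn.
rewrite !sqr_norm2_blocks !(sum_blocks_odd_even (G := fun u => norm2 u ^+ 2))//.
rewrite mulr_sumr; apply: ler_sum => i _; have im := ltn_ord i.
(* The even block is put first in each pair, since it takes the roles of [p] and [a] in
   [sqr_add_le_pair]. *)
rewrite addrC [X in _ * X]addrC.
apply: sqr_add_le_pair; rewrite ?norm2_ge0//.
  have [->|i_neq] := eqVneq (i : nat) m.
    by rewrite block_extract_out ?norm20 ?norm2_ge0// ltnn andbF.
  by rewrite T_coef0_block /= ?odd_double/= ?norm2N//; lia.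
rewrite T_coef0_block /= ?odd_double/=; last by lia.
by rewrite (le_trans (norm2B _ _))// lerD2r.
Qed.

Variables (z : 'cV[R[i]]_(k * n)) (delta : R[i]).
Let d := modulus delta.
Let w := mxpoly_eval (T_pencil A) delta *m z.
Let s : R := Num.sqrt k%:R.

Let c (i : nat) := delta *: A (inord i.*2.+1) + A (inord i.*2).
(** Counting from the bottom makes block row k - 2i, which contains A_(2i+1) and A_(2i), correspond
    to index i and weight delta^i. *)
Let a (i : nat) := block_extract (m - i).*2.+1 z.
Let u (i : nat) := block_extract (m - i).*2.+1 w.
Let e (i : nat) := block_extract (m - i).*2 w.

Lemma T_pencil_block r : block_extract r w
  = block_extract r (T_coef0 A *m z)
    + delta *: block_extract r (T_coef1 A *m z).
Proof.
rewrite /w /mxpoly_eval !big_ord_recl big_ord0 addr0 expr0 scale1r expr1.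
by rewrite mulmxDl -scalemxAl block_extractD block_extractZ.
Qed.

(** This is the even block row 2 (m - i) of w, which involves two odd blocks of z only. *)
Let recE i : (i < m)%N -> delta *: a i = a i.+1 + e i.
Proof.
move=> im; rewrite /e T_pencil_block T_coef0_block ?T_coef1_block; try lia.
rewrite odd_double /a (_ : (m - i.+1).*2.+1 = (m - i).*2.-1); last by lia.
by rewrite addrA subrr add0r.
Qed.

Let sumE : \sum_(i < m.+1) delta ^+ i *: u i
  = \sum_(i < m.+1) delta ^+ i *: (c i *m a i).
Proof.
(* The even blocks of z enter the weighted odd row i as [h i.+1 - h i]. The sum telescopes, and both
   ends vanish because they are blocks 0 and k + 1. *)
pose h i := delta ^+ i *: block_extract (m.+1 - i).*2 z.
have uE (i : 'I_m.+1) :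
    delta ^+ i *: u i = delta ^+ i *: (c i *m a i) + (h i.+1 - h i).
  have im := ltn_ord i.
  rewrite /u T_pencil_block T_coef0_block ?T_coef1_block; try lia.
  rewrite /= odd_double /= /c /a /h.
  rewrite (_ : (k - (m - i).*2.+1)%N = i.*2); last by lia.
  rewrite (_ : (k.+1 - (m - i).*2.+1)%N = i.*2.+1); last by lia.
  rewrite subSS (_ : (m.+1 - i).*2 = (m - i).*2.+2); last by lia.
  rewrite exprSr -scalerA -scalerBr -scalerDr mulmxDl -scalemxAl.
  by congr (_ *: _); rewrite scalerDr addrC addrACA.
rewrite (eq_bigr _ (fun i _ => uE i)) big_split /=.
rewrite -(big_mkord xpredT (fun i => h i.+1 - h i)) telescope_sumr// /h.
rewrite subnn !block_extract_out ?scaler0 ?subrr ?addr0//.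
by rewrite subn0 doubleS ltnn andbF.
Qed.

Let mxpoly_evalE : mxpoly_eval A delta = \sum_(i < m.+1) delta ^+ i.*2 *: c i.
Proof.
rewrite /mxpoly_eval.
under eq_bigr => i _ do rewrite -[i in A i]inord_val.
rewrite -[k.+1]/(m.+1.*2).
rewrite (big_ord_double _ (fun i => delta ^+ i *: A (inord i))).
by apply: eq_bigr => i _; rewrite /c scalerDr scalerA -exprSr addrC.
Qed.

Let sum_norm_le : \sum_(i < m.+1) (norm2 (u i) + norm2 (e i)) <= s * norm2 w.
Proof. exact: sum_norm_blocks_le. Qed.

Lemma recovered_residual_small (C : R) :
  d <= 1 -> 1 <= C -> 2 * m%:R * d <= C ->
  norm2 (mxpoly_eval A delta *m block_extract k z) <= C * K * (s * norm2 w).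
Proof.
move=> d_le1 C_ge1 C_ge; rewrite mxpoly_evalE.
have := recovery_small recE sumE K_ge1 C_ge1 d_le1 C_ge.
rewrite /a subn0; move=> h; apply: le_trans (ler_wpM2l _ sum_norm_le).
  apply: h => i v _; rewrite mulmxDl -scalemxAl.
  rewrite (le_trans (norm2D _ _))// norm2Z -mulrA mulr_natl mulr2n lerD//.
  by rewrite (le_trans _ (norm2_A_le (inord i.*2.+1) v))// ler_piMl ?norm2_ge0.
by rewrite mulr_ge0// (le_trans ler01).
Qed.

Lemma recovered_residual_large (C : R) :
  1 <= d -> 1 <= C -> 2 * m%:R <= C * d ->
  norm2 (mxpoly_eval A delta *m block_extract 1 z)
    <= d ^+ m.*2 * (C * K * (s * norm2 w)).
Proof.
move=> d_ge1 C_ge1 C_ge; rewrite mxpoly_evalE.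
have := recovery_large recE sumE K_ge1 C_ge1 d_ge1 C_ge.
rewrite /a subnn; move=> h.
apply: le_trans (ler_wpM2l _ (ler_wpM2l _ sum_norm_le)).
- apply: h => i v _; rewrite mulmxDl -scalemxAl.
  rewrite (le_trans (norm2D _ _))// norm2Z -/d.
  have -> : 2 * K * d * norm2 v = d * (K * norm2 v) + d * (K * norm2 v) by ring.
  rewrite lerD// ?ler_wpM2l ?modulus_ge0//.
  by rewrite (le_trans (norm2_A_le _ _))// ler_peMl ?mulr_ge0 ?norm2_ge0.
- by rewrite exprn_ge0 ?modulus_ge0.
- by rewrite mulr_ge0// (le_trans ler01).
Qed.

End OddDegree.

(** * Comparison of the two backward errors *)

(** The block (1, 2) is -I. This makes the denominator of the pencil's backward error positive, even
    at [delta = 0]. *)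
Lemma T_coef0_neq0 (R : realType) (n k : nat) (A : 'I_k.+1 -> 'M[R[i]]_n) :
  (0 < n)%N -> (1 < k)%N -> T_coef0 A != 0.
Proof.
move=> n_gt0 k_gt1; pose b : 'I_n := Ordinal n_gt0.
pose i0 : 'I_k := Ordinal (ltnW k_gt1); pose i1 : 'I_k := Ordinal k_gt1.
apply/eqP => /matrixP/(_ (mxtens_index (i0, b)) (mxtens_index (i1, b))).
rewrite !mxE !mxtens_indexK /= !mxE eqxx => /eqP.
by rewrite oppr_eq0 oner_eq0.
Qed.

Lemma sum_T_pencil_norm (R : realType) (n k : nat) (A : 'I_k.+1 -> 'M[R[i]]_n)
    (d : R) :
  \sum_(i < 2) d ^+ i * spectral_norm (T_pencil A i)
    = spectral_norm (T_coef0 A) + d * spectral_norm (T_coef1 A).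
Proof.
have T0E : T_pencil A ord0 = T_coef0 A by [].
have T1E : T_pencil A (lift ord0 ord0) = T_coef1 A by [].
by rewrite big_ord_recl big_ord1 T0E T1E [_ ^+ _]expr0 mul1r lift0 expr1.
Qed.

(** [r] and [w] are the residual norms of P and of the pencil, [SP] and [ST] the weights in their
    backward errors, [X] and [Z] the norms of x and z. [G] is the amplification of the residual and
    [D] stands for max (1, |delta|); both cancel. *)
Lemma ratio_le (F : realFieldType) (r w SP ST X Z G D mu K C s : F) :
  0 <= r -> 0 < w -> 0 < SP -> 0 < ST -> 0 < X -> 0 < Z ->
  0 < G -> 0 < D -> 0 < mu ->
  r <= G * (C * K * (s * w)) -> ST <= 4 * K * D -> G * D * mu <= SP ->
  r / (SP * X) / (w / (ST * Z)) <= 4 * (C * s) * (Z / X) * (K ^+ 2 / mu).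
Proof.
move=> r_ge0 w_gt0 SP_gt0 ST_gt0 X_gt0 Z_gt0 G_gt0 D_gt0 mu_gt0.
move=> r_le ST_le SP_ge.
have -> : r / (SP * X) / (w / (ST * Z)) = r * ST / SP * (Z / (X * w)).
  by field; rewrite !gt_eqF.
have -> : 4 * (C * s) * (Z / X) * (K ^+ 2 / mu)
    = G * (C * K * (s * w)) * (4 * K * D) / (G * D * mu) * (Z / (X * w)).
  by field; rewrite !gt_eqF.
have GD_gt0 : 0 < G * D * mu by rewrite !mulr_gt0.
apply: ler_wpM2r; first by rewrite divr_ge0 ?mulr_ge0 ?ltW.
apply: ler_pM; first by rewrite mulr_ge0// ltW.
- by rewrite invr_ge0 ltW.
- by apply: ler_pM => //; exact: ltW.
- by rewrite lef_pV2 ?posrE.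
Qed.

(** Both final bounds are instances of this one, for two choices of [C]. *)
Lemma backward_error_ratio_le (R : realType) (n m : nat) (m_gt0 : (0 < m)%N)
    (A : 'I_m.*2.+2 -> 'M[R[i]]_n) (z : 'cV[R[i]]_(m.*2.+1 * n))
    (delta : R[i]) (C : R) (x := recovered_vec z delta) :
  A ord_max != 0 -> A ord0 != 0 -> z != 0 -> x != 0 ->
  backward_error (T_pencil A) z delta != 0 ->
  1 <= C -> 2 * m%:R * Num.min (modulus delta) (modulus delta)^-1 <= C ->
  backward_error A x delta / backward_error (T_pencil A) z delta
    <= 4 * (C * Num.sqrt m.*2.+1%:R) * (norm2 z / norm2 x) * rho' A.
Proof.
move=> Ak_neq0 A0_neq0 z_neq0 x_neq0 etaT_neq0 C_ge1 C_ge.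
set d := modulus delta in C_ge *.
have d_ge0 : 0 <= d by exact: modulus_ge0.
pose B : R := \big[Num.max/1]_(i < m.*2.+2) (spectral_norm (A i) ^+ 2).
have B_ge1 : 1 <= B by exact: bigmax_ge_id.
(* With this choice [K] dominates 1 and all |A_i|, while [K ^+ 2] is exactly the numerator of
   [rho']. *)
pose K : R := Num.sqrt B.
have K_ge1 : 1 <= K by rewrite -sqrtr1 ler_wsqrtr.
have K_gt0 : 0 < K := lt_le_trans ltr01 K_ge1.
have K2 : K ^+ 2 = B by rewrite sqr_sqrtr// (le_trans ler01).
have A_le i : spectral_norm (A i) <= K.
  rewrite -[leLHS]ger0_norm ?spectral_norm_ge0// -sqrtr_sqr ler_wsqrtr//.
  exact: (le_bigmax _ (fun i => spectral_norm (A i) ^+ 2)).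
pose mu := Num.min (spectral_norm (A ord_max)) (spectral_norm (A ord0)).
have mu_gt0 : 0 < mu.
  by rewrite lt_min; apply/andP; split; exact: spectral_norm_gt0.
have [mu_le_max mu_le0] :
    mu <= spectral_norm (A ord_max) /\ mu <= spectral_norm (A ord0).
  by apply/andP; rewrite -le_min.
pose SP := \sum_(i < m.*2.+2) d ^+ i * spectral_norm (A i).
pose ST := \sum_(i < 2) d ^+ i * spectral_norm (T_pencil A i).
have SP_ge (i : 'I_m.*2.+2) : d ^+ i * spectral_norm (A i) <= SP.
  rewrite /SP (bigD1 i)//= lerDl sumr_ge0// => j _.
  by rewrite mulr_ge0 ?exprn_ge0 ?spectral_norm_ge0.
have STE : ST = spectral_norm (T_coef0 A) + d * spectral_norm (T_coef1 A).
  exact: sum_T_pencil_norm.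
have n_gt0 : (0 < n)%N.
  rewrite lt0n; apply: contraNneq A0_neq0 => n0.
  by apply/eqP/matrixP => -[p p_lt]; exfalso; move: p_lt; rewrite n0.
have ST_gt0 : 0 < ST.
  rewrite STE ltr_pwDl ?mulr_ge0 ?spectral_norm_ge0//.
  by rewrite spectral_norm_gt0// T_coef0_neq0// ltnS double_gt0.
have SP_gt0 : 0 < SP.
  apply: lt_le_trans (SP_ge ord0); rewrite expr0 mul1r.
  exact: spectral_norm_gt0.
have x_gt0 : 0 < norm2 x by rewrite norm2_gt0.
have z_gt0 : 0 < norm2 z by rewrite norm2_gt0.
have ST_le : ST <= 2 * K + d * (2 * K).
  rewrite STE; apply: lerD; first exact: spectral_norm_T_coef0.
  by apply: ler_wpM2l => //; exact: spectral_norm_T_coef1.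
move: etaT_neq0; rewrite (backward_errorE z_neq0 ST_gt0).
rewrite (backward_errorE x_neq0 SP_gt0) -/ST -/SP.
rewrite /rho' -/B -/mu -K2; clearbody mu SP ST.
set w := norm2 (mxpoly_eval (T_pencil A) delta *m z).
set r := norm2 (mxpoly_eval A delta *m x).
set s : R := Num.sqrt _.
rewrite mulf_eq0 negb_or => /andP[w_neq0 _].
have w_gt0 : 0 < w by rewrite lt_def w_neq0 norm2_ge0.
have r_ge0 : 0 <= r by exact: norm2_ge0.
suff [G [D [G_gt0 D_gt0 [r_le ST_leD SP_geD]]]] : exists G D : R,
    [/\ 0 < G, 0 < D
      & [/\ r <= G * (C * K * (s * w)), ST <= 4 * K * D & G * D * mu <= SP]].
  exact: (@ratio_le _ r w SP ST _ _ G D).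
have [d_le1|d_gt1] := leP d 1.
  have md_le : 2 * m%:R * d <= C.
    apply: le_trans C_ge; rewrite ler_wpM2l ?mulr_ge0// le_min lexx /=.
    (* Since the inverse of 0 is 0, [d <= d^-1] holds at [d = 0] too. *)
    have [d0|d_neq0] := eqVneq d 0; first by rewrite d0 invr0.
    have d_gt0 : 0 < d by rewrite lt_def d_neq0.
    by rewrite (le_trans d_le1)// invf_ge1.
  (* No amplification here; [SP] is bounded below by its constant term |A_0|. *)
  exists 1, 1; rewrite ltr01 !mul1r mulr1; split=> //; split.
  - rewrite /r /x /recovered_vec -/d ltNge d_le1 /=.
    exact: recovered_residual_small.
  - apply: (le_trans ST_le); rewrite (_ : 4 * K = 2 * K + 2 * K); last by ring.
    by rewrite lerD2l ler_piMl// mulr_ge0// ltW.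
  - apply: le_trans (SP_ge ord0); by rewrite expr0 mul1r.
have d_gt0 : 0 < d := lt_trans ltr01 d_gt1.
have md_le : 2 * m%:R <= C * d.
  rewrite -ler_pdivrMr// (le_trans _ C_ge)// ler_wpM2l ?mulr_ge0//.
  by rewrite le_min lexx andbT (le_trans _ (ltW d_gt1))// invf_le1// ltW.
(* The product [G * D] is d^k, matched by the leading term d^k |A_k| of [SP]. *)
exists (d ^+ m.*2), d; rewrite exprn_gt0 ?d_gt0//; split=> //; split.
- rewrite /r /x /recovered_vec -/d d_gt1.
  by apply: recovered_residual_large => //; exact: ltW.
- apply: (le_trans ST_le).
  rewrite (_ : 4 * K * d = d * (2 * K) + d * (2 * K)); last by ring.
  by rewrite lerD2r ler_peMl ?mulr_ge0// ltW.
- rewrite -exprSr; have /= SP_max := SP_ge ord_max.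
  apply: le_trans SP_max.
  by apply: ler_wpM2l; [exact: exprn_ge0|exact: mu_le_max].
Qed.

(* For delta = 0, (modulus delta)^-1 = 0 and the minimum below is 0, as it is
   with the convention 1 / 0 = +oo. *)
Theorem theorem5p3 (R : realType) (n k : nat) (k_gt2 : (2 < k)%N)
    (k_odd : odd k) (A : 'I_k.+1 -> 'M[R[i]]_n)
    (Ak_neq0 : A ord_max != 0) (A0_neq0 : A ord0 != 0)
    (z : 'cV[R[i]]_(k * n)) (delta : R[i])
    (z_eigenpair : approx_right_eigenpair (T_pencil A) z delta)
    (x : 'cV[R[i]]_n) (x_def : x = recovered_vec z delta) (x_neq0 : x != 0)
    (etaT_neq0 : backward_error (T_pencil A) z delta != 0) :
  approx_right_eigenpair A x delta /\
  backward_error A x delta / backward_error (T_pencil A) z delta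
    <= 4 * (k%:R `^ (3 / 2)) * (norm2 z / norm2 x) * rho' A /\
  (modulus delta != 1 ->
   Num.min (modulus delta) (modulus delta)^-1 <= 1 / (k%:R - 1) ->
   backward_error A x delta / backward_error (T_pencil A) z delta
     <= 4 * Num.sqrt (k.+1)%:R * (norm2 z / norm2 x) * rho' A).
Proof.
subst x; split=> //.
have kE : k = (k./2).*2.+1 by rewrite -[LHS]odd_double_half k_odd.
(* The types of [A] and [z] depend on k, so they are generalized before k is replaced by 2 m + 1. *)
move: k_gt2 k_odd A Ak_neq0 A0_neq0 z z_eigenpair x_neq0 etaT_neq0.
rewrite kE; set m := k./2.
move=> k_gt2 _ A Ak_neq0 A0_neq0 z z_neq0 x_neq0 etaT_neq0.
clearbody m; clear k kE.
have m_gt0 : (0 < m)%N by rewrite -double_gt0; lia.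
have m1 : 1 <= m%:R :> R by rewrite ler1n.
have kR : m.*2.+1%:R = 2 * m%:R + 1 :> R.
  by rewrite -natr1 -muln2 natrM mulrC.
set y := norm2 z / norm2 _.
have rest_ge0 : 0 <= y * rho' A.
  rewrite !mulr_ge0 ?invr_ge0 ?norm2_ge0//; last first.
    by rewrite le_min; apply/andP; split; exact: spectral_norm_ge0.
  by rewrite (le_trans ler01)// bigmax_ge_id.
have ratio_le C := backward_error_ratio_le m_gt0 Ak_neq0 A0_neq0 z_neq0 x_neq0
  etaT_neq0 (C := C).
split=> [|_ delta_le].
(* As min (|delta|, 1 / |delta|) <= 1, [C] can be 2 m = k - 1, and (k - 1) sqrt k <= k^(3/2). *)
- apply: le_trans (ratio_le (2 * m%:R) _ _) _.
  + by lra.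
  + have min_le1 : Num.min (modulus delta) (modulus delta)^-1 <= 1.
      rewrite ge_min; have [//|d_gt1] := leP (modulus delta) 1.
      by rewrite invf_le1 ?(ltW d_gt1)// (lt_trans ltr01).
    by rewrite ler_piMr// mulr_ge0.
  rewrite -/y -[leLHS]mulrA -[leRHS]mulrA ler_wpM2r// ler_wpM2l//.
  rewrite (_ : 3 / 2 = 1 + 2^-1 :> R); last by field.
  rewrite powRD; last by rewrite pnatr_eq0 implybT.
  rewrite powRr1// powR12_sqrt// ler_wpM2r ?sqrtr_ge0// kR.
  by rewrite lerDl.
(* As k - 1 = 2 m, the assumption on [delta] says precisely that [C = 1] is allowed; then sqrt k <=
   sqrt (k + 1). *)
- apply: le_trans (ratio_le 1 _ _) _ => //.
    move: delta_le; rewrite kR addrK ler_pdivlMr; last by lra.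
    by rewrite mulrC.
  rewrite mul1r -/y -[leLHS]mulrA -[leRHS]mulrA ler_wpM2r// ler_wpM2l//.
  by rewrite ler_wsqrtr// ler_nat.
Qed.
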